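(* Let $p$ be an even positive integer and $\tau,i,j$ non-negative integers. Let $\mu=\frac{p^2}{4}+2p+2$, $\gamma=2\mu-\left(\frac p2+4\right)$, $m=\mu+\tau\frac p2$, $g=\gamma+\tau(p-1)$, $c=p\mu+\tau\left(\frac{p^2}{2}-1\right)$; and let $m^{(i,j)}=m+j\frac p2$, $g^{(i,j)}=g+j(p-1)+i\,m^{(i,j)}$, $c^{(i,j)}=c+j\frac{p^2}{2}+i\left(\frac p2+1\right)m^{(i,j)}$, $S^{(i,j)}(p,\tau)=\langle m^{(i,j)},g^{(i,j)},g^{(i,j)}+1\rangle_{c^{(i,j)}}$. Then \begin{align*} \mathrm{W}(S^{(i,j)}(p,\tau))&=\frac{p^5}{192}+\frac{5p^4}{64}+\frac{p^3}{4}-\frac{7p^2}{16}+\frac{p}{6}+\tau\left(\frac{p^4}{48}+\frac{3}{16}p^3+\frac{1}{24}p^2+1\right)\\ &\quad+i\left(\frac{p^5}{384}+\frac{3p^4}{64}+\frac{7p^3}{32}+\frac{p^2}{16}-\frac{5p}{12}\right)+j\left(\frac{p^4}{48}+\frac{3p^3}{16}+\frac{p^2}{24}\right)\\ &\quad+ij\left(\frac{p^4}{96}+\frac{p^3}{8}+\frac{5p^2}{24}\right)+i\tau\left(\frac{p^4}{96}+\frac{p^3}{8}+\frac{5p^2}{24}\right). \end{align*}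
   Context: A numerical semigroup is a submonoid of $(\mathbb N,+)$ with finite complement. For integers $a_1,\dots,a_r$ and $t$, $\langle a_1,\dots,a_r\rangle_t$ denotes the smallest numerical semigroup containing $a_1,\dots,a_r$ and all integers $\ge t$. For a numerical semigroup $S$ with conductor $c(S)$ (smallest integer such that all integers $\ge c(S)$ are in $S$), let $L=\{s\in S:s<c(S)\}$ and $P$ the set of minimal generators. The Wilf number is $\mathrm{W}(S)=|P|\,|L|-c(S)$. *)

(* Defs.v *)
From mathcomp Require Import all_boot all_order all_algebra.
From mathcomp Require Import finmap mathcomp_extra boolp classical_sets.
From mathcomp Require Import functions cardinality.
From mathcomp Require Import zify.

Set Implicit Arguments.
Unset Strict Implicit.
Unset Printing Implicit Defensive.

Import Order.TTheory GRing.Theory Num.Theory.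

Local Open Scope classical_set_scope.
Local Open Scope nat_scope.

Definition submonoid (A : set nat) : Prop :=
  A 0 /\ forall x y, A x -> A y -> A (x + y).

Definition numerical_semigroup (A : set nat) : Prop :=
  submonoid A /\ finite_set (~` A).

Record numsg := NumSg {
  numsg_set :> set nat;
  numsgP : numerical_semigroup numsg_set
}.

Lemma numsg_eventually (S : numsg) :
  exists c, `[< [set n | c <= n] `<=` S >].
Proof.
have [_ /finite_seqP[s sE]] := numsgP S.
exists (\max_(x <- s) x).+1; apply/asboolP => n /= ltn; apply: contrapT => Sn.
have ns : n \in s by have : (~` S) n := Sn; rewrite sE.
have := leq_bigmax_seq n (P := predT) (F := id) ns isT.
by rewrite leqNgt ltn.
Qed.

Definition conductor (S : numsg) : nat := ex_minn (numsg_eventually S).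

Lemma conductorP (S : numsg) : [set n | conductor S <= n] `<=` S.
Proof. by rewrite /conductor; case: ex_minnP => c /asboolP. Qed.

Lemma conductor_min (S : numsg) c :
  [set n | c <= n] `<=` S -> conductor S <= c.
Proof.
by rewrite /conductor; case: ex_minnP => d _ dmin Sc; apply/dmin/asboolP.
Qed.

Definition submonoid_gen (A : set nat) : set nat := smallest submonoid A.

Lemma submonoid_gen_submonoid A : submonoid (submonoid_gen A).
Proof.
split; first by move=> M [[M0 _] _].
move=> x y Ax Ay M CM; have [[_ MD] _] := CM.
exact: MD (Ax M CM) (Ay M CM).
Qed.

Definition minimal_generating_set (S A : set nat) : Prop :=
  submonoid_gen A = S /\
  forall B : set nat, B `<=` A -> submonoid_gen B = S -> B = A.

(* By [minimal_generating_set_uniq] below, a numerical semigroup has exactly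
   one minimal generating set, and this is it. *)
Definition minimal_generators (S : set nat) : set nat :=
  [set x | exists2 A, minimal_generating_set S A & A x].

Definition left_elements (S : numsg) : set nat :=
  S `&` [set s | s < conductor S].

(* [fset_set] is [fset0] on infinite sets; both sets here are finite, by
   [finite_minimal_generators] and [finite_left_elements] below. *)
Definition wilf_number (S : numsg) : int :=
  ((#|` fset_set (minimal_generators S)| *
    #|` fset_set (left_elements S)|)%N%:Z - (conductor S)%:Z)%R.

Definition gen_numsg_set (l : seq nat) (t : nat) : set nat :=
  smallest numerical_semigroup ([set` l] `|` [set n | t <= n]).

(* An intersection of numerical semigroups need not be cofinite; this one is,
   since each of them contains all integers [>= t]. *)
Lemma gen_numsg_setP l t : numerical_semigroup (gen_numsg_set l t).
Proof.
split; [split|].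
- by move=> M [[[M0 _] _] _].
- move=> x y Ax Ay M CM; have [[[_ MD] _] _] := CM.
  exact: MD (Ax M CM) (Ay M CM).
- apply: sub_finite_set (finite_II t) => n /= nA; rewrite ltnNge.
  by apply/negP => tn; apply: nA => M [_ AM]; apply: AM; right.
Qed.

Definition gen_numsg (l : seq nat) (t : nat) : numsg :=
  NumSg (gen_numsg_setP l t).

Definition irreducibles (S : set nat) : set nat :=
  [set x | [/\ S x, 0 < x &
    forall y z, S y -> S z -> 0 < y -> 0 < z -> x <> y + z]].

Lemma irreducibles_sub (S A : set nat) :
  submonoid_gen A = S -> irreducibles S `<=` A.
Proof.
move=> AS x [Sx x0 xirr]; apply: contrapT => Ax.
have [S0 SD] : submonoid S by rewrite -AS; exact: submonoid_gen_submonoid.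
have : submonoid_gen A `<=` [set y | S y /\ y <> x].
  apply: smallest_sub.
  - split; first by split=> //; lia.
    move=> y z [Sy yx] [Sz zx]; split; first exact: SD.
    move=> yzx; have [y0|y0] := posnP y; first by apply: zx; lia.
    have [z0|z0] := posnP z; first by apply: yx; lia.
    exact: (xirr y z).
  - move=> y Ay; split; last by move=> yx; apply: Ax; rewrite -yx.
    by rewrite -AS; apply: sub_gen_smallest.
by move=> /(_ x); rewrite AS => /(_ Sx)[].
Qed.

Lemma irreducibles_gen (S : set nat) :
  submonoid S -> submonoid_gen (irreducibles S) = S.
Proof.
move=> Ssub; apply/seteqP; split.
  by apply: smallest_sub => // x [].
have [I0 ID] := submonoid_gen_submonoid (irreducibles S).
elim/ltn_ind => x IH Sx; have [->//|x0] := posnP x.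
have [xI|xI] := pselect (irreducibles S x); first exact: sub_gen_smallest.
have [[y [z [Sy Sz y0 z0 xE]]]|no] :=
    pselect (exists y z, [/\ S y, S z, 0 < y, 0 < z & x = y + z]).
  by rewrite xE; apply: ID; apply: IH => //; lia.
case: xI; split=> // y z Sy Sz y0 z0 xE; apply: no.
by exists y, z.
Qed.

Lemma minimal_generating_set_uniq (S A : set nat) : submonoid S ->
  minimal_generating_set S A <-> A = minimal_generators S.
Proof.
move=> Ssub; have IS := irreducibles_gen Ssub.
have minI : minimal_generating_set S (irreducibles S).
  split=> // B BI BS; apply/seteqP; split=> //; exact: irreducibles_sub.
have minE B : minimal_generating_set S B -> B = irreducibles S.
  by move=> [BS Bmin]; rewrite (Bmin _ (irreducibles_sub BS) IS).
have -> : minimal_generators S = irreducibles S.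
  apply/seteqP; split=> [x [B /minE ->]//|x xI].
  by exists (irreducibles S).
by split=> [/minE|->].
Qed.

Lemma minimal_generatorsE (S : set nat) :
  submonoid S -> minimal_generators S = irreducibles S.
Proof.
move=> Ssub; have [_ /(_ erefl)[gS _]] :=
  minimal_generating_set_uniq (minimal_generators S) Ssub.
apply/seteqP; split; last exact: irreducibles_sub gS.
move=> x [B [BS Bmin] Bx].
by rewrite (Bmin _ (irreducibles_sub BS) (irreducibles_gen Ssub)).
Qed.

Lemma finite_minimal_generators (S : numsg) :
  finite_set (minimal_generators S).
Proof.
have [Ssub _] := numsgP S; rewrite minimal_generatorsE //.
apply: sub_finite_set (finite_II (conductor S).+1.*2) => x [Sx x0 xirr] /=.
rewrite ltnNge; apply/negP => lex.
apply: (xirr (conductor S).+1 (x - (conductor S).+1)); try lia;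
  by apply: conductorP => /=; lia.
Qed.

Lemma finite_left_elements (S : numsg) : finite_set (left_elements S).
Proof. by apply: sub_finite_set (finite_II (conductor S)) => x []. Qed.

(* Main.v *)
(* Put q = p/2, d = q + 4 + tau + j and K = 2q + i(q+1). Then m^(i,j) = qd + 2,
   g^(i,j) = (i+2) m^(i,j) - d and c^(i,j) = K m^(i,j) - tau; write M, G, C for
   them. Modulo M, the elements bG + e with 0 <= e <= b are -(bd - e). For
   1 <= b <= q these residues fill disjoint intervals, for b = q + 1 they fill
   one more gap, and for b >= q + 2 the elements are beyond C + M. So the pairs
   (b, e) with e <= b <= q + 1 parametrize the classes in which <M, G, G+1>
   meets the window [C, C + M), each class being entered at level
   N(b) = K + [b > 0] - b(i+2): the elements bG + e + aM with a < N(b) are the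
   left elements, and those with a = N(b) lie in the window. The minimal
   generators are M, G, G + 1 and the rest of the window. *)
Require Import Defs.
From mathcomp Require Import all_boot all_order all_algebra.
From mathcomp Require Import finmap boolp classical_sets cardinality.
From mathcomp Require Import zify ring lra.

Import Order.TTheory GRing.Theory Num.Theory.

Local Open Scope ring_scope.

Lemma card_set_seq (T : choiceType) (s : seq T) (A : set T) :
  uniq s -> (forall x, A x <-> x \in s) -> #|` fset_set A|%N = size s.
Proof.
move=> us As; have -> : A = [set` [fset x in s]%fset]%classic.
  by apply/seteqP; split=> x /=; rewrite !inE => /As.
by rewrite set_fsetK card_fseq undup_id.
Qed.

(** * Counting for a semigroup generated by M, G, G + 1 and a tail *)

Section TwoConsecutiveGenerators.

Set Implicit Arguments.
Unset Strict Implicit.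

Local Open Scope classical_set_scope.
Local Open Scope nat_scope.

Variables (M G C : nat).
Hypotheses (M_gt0 : 0 < M) (ltMG : M < G) (ltGC : G.+1 < C).
Hypotheses (ndvdMG : ~~ (M %| G)) (ndvdMG1 : ~~ (M %| G.+1)).

(** Of the [b] large generators, [b - e] are [G] and [e] are [G.+1]. *)
Definition consec_monoid (x : nat) : Prop :=
  exists a b e, e <= b /\ x = a * M + b * G + e.

Lemma consec_monoidD x y :
  consec_monoid x -> consec_monoid y -> consec_monoid (x + y).
Proof.
move=> [a [b [e [leeb ->]]]] [a' [b' [e' [leeb' ->]]]].
by exists (a + a'), (b + b'), (e + e'); split; lia.
Qed.

Let Sg := gen_numsg [:: M; G; G.+1] C.
Let S : set nat := Sg.

Lemma gen_consecE x : S x <-> consec_monoid x \/ C <= x.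
Proof.
split.
  suff : S `<=` [set x | consec_monoid x \/ C <= x] by apply.
  apply: smallest_sub => [|y /= []]; last 2 first.
  - rewrite !inE => /or3P[] /eqP ->; left.
    + by exists 1, 0, 0; split; lia.
    + by exists 0, 1, 0; split; lia.
    + by exists 0, 1, 1; split; lia.
  - by right.
  split; last first.
    apply: sub_finite_set (finite_II C) => y /= ny; rewrite ltnNge.
    by apply/negP => leCy; apply: ny; right.
  split; first by left; exists 0, 0, 0.
  move=> y z /= [Ty|Cy] [Tz|Cz]; try by right; lia.
  by left; apply: consec_monoidD.
have [[S0 SD] _] := numsgP Sg.
have sub y : ([set` [:: M; G; G.+1]] `|` [set n | C <= n]) y -> S y.
  by move=> ? A [_]; apply.
case=> [[a [b [e [leeb ->]]]]|leCx]; last by apply: sub; right.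
have SM : S M by apply: sub; left; rewrite /= !inE eqxx.
have SG : S G by apply: sub; left; rewrite /= !inE eqxx orbT.
have SG1 : S G.+1 by apply: sub; left; rewrite /= !inE eqxx !orbT.
have Smul n y : S y -> S (n * y).
  by move=> Sy; elim: n => [//|n IHn]; rewrite mulSn; apply: SD.
have -> : a * M + b * G + e = a * M + ((b - e) * G + e * G.+1) by nia.
by apply: (SD); [|apply: (SD)]; apply: Smul.
Qed.

(* [D] lists the pairs (b, e) for which bG + e can occur below C + M, and
   [N (b, e)] is the number of multiples of M to add to reach [C, C + M). *)
Variables (D : seq (nat * nat)) (N : nat * nat -> nat).
Hypotheses (D_uniq : uniq D) (D_le : {in D, forall p, p.2 <= p.1}).

Let w p := p.1 * G + p.2.
Let v p := w p + N p * M.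

Hypothesis v_inj : {in D &, injective v}.
Hypothesis v_window : {in D, forall p, C <= v p < C + M}.
Hypothesis notin_D :
  forall b e, e <= b -> (b, e) \notin D -> C + M <= b * G + e.
(** Were [v p = C.-1 + M] with [0 < N p], removing one [M] would put [C.-1] in the semigroup. *)
Hypothesis conductor_gap : {in D, forall p, 0 < N p -> v p <> C.-1 + M}.

(** The progression [w p + a * M] meets [C, C + M) only at [a = N p], so comparing [x] with [C]
    amounts to comparing [a] with [N p]. *)
Lemma consec_lt_window x : consec_monoid x -> x < C + M ->
  exists a p, [/\ p \in D, a <= N p, x = w p + a * M & (x < C) = (a < N p)].
Proof.
move=> [a [b [e [leeb xE]]]] xlt.
have pD : (b, e) \in D.
  by apply/negPn/negP => /(notin_D leeb) ?; nia.
have /andP[vge vlt] := v_window pD.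
exists a, (b, e); rewrite /v /w /= in vge vlt *.
have leaN : a <= N (b, e) by rewrite leqNgt; apply/negP => ?; nia.
split=> //; first lia.
apply/idP/idP => lt; rewrite ltnNge; apply/negP => le.
  have aE : a = N (b, e) by lia.
  by rewrite -aE in vge; lia.
have := leq_mul2r M a.+1 (N (b, e)); rewrite lt orbT mulSn => /idP ?; lia.
Qed.

Lemma consec_w p a : p \in D -> consec_monoid (w p + a * M).
Proof.
by move=> /D_le le; exists a, p.1, p.2; split=> //; rewrite addnC addnA.
Qed.

Lemma gen_consec_conductor : conductor Sg = C.
Proof.
apply/eqP; rewrite eqn_leq; apply/andP; split.
  by apply: (@conductor_min Sg) => x /= ?; apply/gen_consecE; right.
rewrite leqNgt; apply/negP => lt.
have : S C.-1 by have /(_ C.-1) := @conductorP Sg; apply => /=; lia.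
move=> /gen_consecE[T|]; last lia.
have [|a [p [pD leaN xE ltx]]] := consec_lt_window T; first lia.
have ltaN : a < N p by rewrite -ltx; lia.
have /andP[vge vlt] := v_window pD.
apply: (conductor_gap pD); first lia.
rewrite /v in vge vlt *.
have -> : N p = a.+1; last by nia.
by apply/eqP; rewrite eqn_leq ltaN leqNgt andbT; apply/negP => ?; nia.
Qed.

Lemma card_left_consec :
  #|` fset_set (left_elements Sg)| = sumn [seq N p | p <- D].
Proof.
rewrite (@card_set_seq _ [seq w p + a * M | p <- D, a <- iota 0 (N p)]).
- rewrite size_allpairs_dep; congr sumn; apply: eq_map => p.
  by rewrite size_iota.
- apply: allpairs_uniq_dep => //; first by move=> *; exact: iota_uniq.
  move=> [p a] [p' a'] /allpairsPdep[p1 [a1 [pD aN E1]]].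
  move=> /allpairsPdep[p2 [a2 [p'D a'N E2]]] /= eqw.
  case: E1 => ??; case: E2 => ??; subst.
  have /andP[vge vlt] := v_window pD.
  have /andP[v'ge v'lt] := v_window p'D.
  (* Congruent modulo [M] and in a window of length [M], the two values coincide. *)
  have vE : v p1 = v p2.
    rewrite /v in vge vlt v'ge v'lt *.
    have : N p1 + a2 = N p2 + a1; last by nia.
    by case: (ltngtP (N p1 + a2) (N p2 + a1)) => // ?; nia.
  have pE := v_inj pD p'D vE; subst.
  by have -> : a1 = a2 by nia.
- move=> x; rewrite /left_elements gen_consec_conductor; split.
    move=> [/gen_consecE[T|le] /= ltx]; last lia.
    have [|a [p [pD leaN xE lta]]] := consec_lt_window T; first lia.
    apply/allpairsPdep; exists p, a; split=> //.
    by rewrite mem_iota -lta.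
  move=> /allpairsPdep[p [a [pD]]]; rewrite mem_iota /= add0n => ltaN ->.
  have /andP[vge vlt] := v_window pD.
  split; first by apply/gen_consecE; left; apply: consec_w.
  by rewrite /= /v in vge vlt *; nia.
Qed.

Lemma gen_consec_ge x : S x -> 0 < x -> M <= x.
Proof.
move=> /gen_consecE[[a [b [e [leeb ->]]]]|]; last lia.
by case: a b leeb => [|a] [|b]; nia.
Qed.

(** Nonzero elements of [S] are at least [M], so when [x < C + M] splits in [S], both summands are
    below [C] and lie in [consec_monoid]. *)
Lemma gen_consec_irred x : S x -> x < C + M ->
  (forall y z, consec_monoid y -> consec_monoid z -> 0 < y -> 0 < z ->
    x <> y + z) ->
  0 < x -> irreducibles S x.
Proof.
move=> Sx xlt irr x0; split=> // y z Sy Sz y0 z0 xE.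
have := gen_consec_ge Sy y0; have := gen_consec_ge Sz z0 => ??.
case/gen_consecE: Sy => [Ty|]; last lia.
case/gen_consecE: Sz => [Tz|]; last lia.
exact: (irr y z).
Qed.

Lemma irreducible_generator x : x \in [:: M; G; G.+1] -> irreducibles S x.
Proof.
move=> xin.
have Tx : consec_monoid x.
  move: xin; rewrite !inE => /or3P[] /eqP ->.
  + by exists 1, 0, 0; split; lia.
  + by exists 0, 1, 0; split; lia.
  + by exists 0, 1, 1; split; lia.
have nd a : x = a * M -> x = M.
  by move=> xE; move: xin ndvdMG ndvdMG1; rewrite !inE => /or3P[] /eqP <- //;
    rewrite xE dvdn_mull.
have [xge xle] : M <= x /\ x <= G.+1.
  by move: xin; rewrite !inE => /or3P[] /eqP ->; split; lia.
apply: gen_consec_irred; try lia; first by apply/gen_consecE; left.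
move=> _ _ [a [b [e [leeb ->]]]] [a' [b' [e' [leeb' ->]]]] y0 z0 xE.
have [b0|b0] := posnP (b + b').
  have ? : b = 0 by lia. have ? : b' = 0 by lia.
  have ? : e = 0 by lia. have ? : e' = 0 by lia.
  have xE' : x = (a + a') * M by nia.
  have := nd _ xE'; rewrite {}xE'.
  by case: a a' {xE} y0 z0 => [|a] [|a']; nia.
(* As [x <= G.+1] and [1 < M], one copy of [G] or [G.+1] leaves no room for more, so the other
   summand is zero. *)
have b1 : b + b' = 1 by nia.
have a0 : a + a' = 0 by nia.
have [b00|b00] : b = 0 \/ b' = 0 by lia.
  by case: a b e {xE} b00 a0 b0 b1 leeb y0 => [|a] [|b] [|e] //; lia.
by case: a' b' e' {xE} b00 a0 b0 b1 leeb' z0 => [|a'] [|b'] [|e'] //; lia.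
Qed.

(** The [M] integers of the window split into the [size D] values [v p], which decompose, and the
    others, which are irreducible. *)
Lemma card_minimal_generators_consec :
  #|` fset_set (minimal_generators S)| + size D = 3 + M.
Proof.
have [Ssub _] := numsgP Sg; rewrite minimal_generatorsE //.
pose A := [seq v p | p <- D].
have A_uniq : uniq A by rewrite map_inj_in_uniq.
pose B := [seq x <- iota C M | x \notin A].
have BE x : (x \in B) = [&& x \notin A, C <= x & x < C + M].
  by rewrite mem_filter mem_iota.
have sizeB : size B + size D = M.
  rewrite -[RHS](size_iota C M) -(count_predC (mem A) (iota C M)) /B.
  rewrite size_filter addnC.
  congr addn; rewrite -(size_map v) -size_filter; apply: perm_size.
  apply: uniq_perm => //; first by rewrite filter_uniq ?iota_uniq.
  move=> x; rewrite mem_filter mem_iota /=; case: (boolP (x \in A)) => //.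
  by case/mapP => p pD ->; rewrite (v_window pD).
rewrite (@card_set_seq _ ([:: M; G; G.+1] ++ B)).
- by rewrite size_cat -addnA sizeB.
- rewrite cat_uniq filter_uniq ?iota_uniq // andbT; apply/andP; split.
    by rewrite /= !inE; lia.
  apply/hasPn => x; rewrite BE => /and3P[_ lex _].
  by rewrite !inE; lia.
move=> x; rewrite mem_cat; split; last first.
  case/orP => [/irreducible_generator//|]; rewrite BE => /and3P[xA lex ltx].
  apply: gen_consec_irred => //; [by apply/gen_consecE; right| |lia].
  move=> y z Ty Tz _ _ xE; move/negP: xA; apply.
  have [|a [p [pD leaN xE' lta]]] := consec_lt_window (consec_monoidD Ty Tz).
    by rewrite -xE.
  apply/mapP; exists p => //; rewrite xE xE' /v; congr (_ + _ * _).
  by apply/eqP; rewrite eqn_leq leaN /= leqNgt -lta; lia.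
move=> [Sx x0 xirr].
have gen_sub y : y \in [:: M; G; G.+1] -> consec_monoid (x - y) ->
    y <= x -> x = y.
  move=> yin Txy lexy; apply/eqP; apply: contrapT => /eqP neq.
  have [Sy y0 _] := irreducible_generator yin.
  apply: (xirr y (x - y)) => //; try lia.
  by apply/gen_consecE; left.
case: (pselect (consec_monoid x)) => [[a [b [e [leeb xE]]]]|nTx].
  suff [y yin ->] : exists2 y, y \in [:: M; G; G.+1] & x = y by rewrite yin.
  have [a0|a0] := posnP a; last first.
    exists M; first by rewrite !inE eqxx.
    apply: gen_sub; [by rewrite !inE eqxx| |nia].
    by exists a.-1, b, e; split=> //; nia.
  case: b leeb xE => [|b] leeb xE; first lia.
  case: e leeb xE => [|e] leeb xE.
    exists G; first by rewrite !inE eqxx orbT.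
    apply: gen_sub; [by rewrite !inE eqxx orbT| |nia].
    by exists 0, b, 0; split=> //; nia.
  exists G.+1; first by rewrite !inE eqxx !orbT.
  apply: gen_sub; [by rewrite !inE eqxx !orbT| |nia].
  by exists 0, b, e; split; nia.
case/gen_consecE: (Sx) => // lex; apply/orP; right; rewrite BE lex /=.
apply/andP; split.
  apply/negP => /mapP[p pD xE]; apply: nTx; rewrite xE; exact: consec_w.
(* Past the window, [x - M] is still at least [C], so [x] decomposes. *)
rewrite ltnNge; apply/negP => lex'; apply: (xirr M (x - M)); try lia.
- by apply/gen_consecE; left; exists 1, 0, 0; split; lia.
- by apply/gen_consecE; right; lia.
Qed.

Lemma wilf_number_consec : wilf_number Sg =
  (((3 + M - size D) * sumn [seq N p | p <- D])%N%:Z - C%:Z)%R.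
Proof.
by rewrite /wilf_number card_left_consec gen_consec_conductor
  -card_minimal_generators_consec addnK.
Qed.

End TwoConsecutiveGenerators.

(** * Residue classes and counts for the family *)

Section Family.

Set Implicit Arguments.
Unset Strict Implicit.

Local Open Scope nat_scope.

Variables (q d t i M G K C : nat).
Hypotheses (q_gt0 : 0 < q) (d_ge : q + 4 + t <= d).
Hypotheses (ME : M = q * d + 2) (GE : G + d = (i + 2) * M).
Hypotheses (KE : K = 2 * q + i * (q + 1)) (CE : C + t = K * M).

Let D := [seq (b, e) | b <- iota 0 q.+2, e <- iota 0 b.+1].
Let N (p : nat * nat) := K + (0 < p.1) - p.1 * (i + 2).
Let v p := p.1 * G + p.2 + N p * M.

(* The distance from [v (b, e)] up to (K + 1)M. *)
Let off b e := if b == 0 then M else if b <= q then b * d - e else d - 2 - e.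

Let mem_D b e : ((b, e) \in D) = (b <= q.+1) && (e <= b).
Proof.
apply/allpairsPdep/andP => [[b' [e' []]]|[leb lee]].
  by rewrite !mem_iota /= !add0n !ltnS => ? ? [-> ->].
by exists b, e; rewrite !mem_iota.
Qed.

Let ltdM : d < M. Proof. by rewrite ME; nia. Qed.

Let N_mid b e : 0 < b -> b <= q -> N (b, e) + b * (i + 2) = K.+1.
Proof. by move=> b0 leb; rewrite /N /= b0 addn1 subnK // KE; nia. Qed.

(** Since [(q + 1) * (i + 2) = K + 2], the difference in [N] would be -1 and truncates to 0: this
    row is in the window without any [M]. *)
Let N_top e : N (q.+1, e) = 0.
Proof. by apply/eqP; rewrite /N subn_eq0 /= KE; lia. Qed.

Let vE b e : b <= q.+1 -> e <= b -> v (b, e) + off b e = K.+1 * M.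
Proof.
move=> leb lee; rewrite /off /v /=; case: eqP => [b0|/eqP b0].
  have e0 : e = 0 by lia.
  by rewrite b0 e0 /N /=; lia.
have bG : b * G + b * d = b * (i + 2) * M by rewrite -mulnDr GE mulnA.
case: leqP => [leq|gtq].
  have lebd : e <= b * d by apply: leq_trans lee _; rewrite leq_pmulr; lia.
  by rewrite -(@N_mid b e) ?lt0n // mulnDl; lia.
have {}b0 : b = q.+1 by lia.
subst b; rewrite N_top.
(* Here [(q + 1) * d = M + (d - 2)] wraps once around [M], which leaves the offset [d - 2 - e]. *)
have topE : q.+1 * (i + 2) = K.+2 by rewrite KE; lia.
have dE : q.+1 * d + 2 = M + d by rewrite ME; lia.
by move: bG; rewrite topE [K.+2 * M]mulSn; lia.
Qed.

(** As [C + M = K.+1 * M - t], these bounds put [v (b, e)] in the window. The case [b = e = q.+1]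
    reads [t < d - q - 3], which is [d_ge]. *)
Let off_gt b e : b <= q.+1 -> e <= b -> t < off b e <= M.
Proof.
move=> leb lee; have leqd : d <= q * d by rewrite leq_pmull.
rewrite /off ME; case: eqP => [b0|/eqP b0]; first by lia.
case: (leqP b q) => [leq|gtq]; last by lia.
have leM : b * d <= q * d by rewrite leq_mul2r leq orbT.
have ged : d <= b * d by rewrite leq_pmull // lt0n.
by apply/andP; split; lia.
Qed.

(** In increasing order, row q + 1 has offsets in [d - q - 3, d - 2], row b in [bd - b, bd] for 1 <=
    b <= q, and row 0 only qd + 2; these are disjoint because q + 1 < d. *)
Let off_inj b e b' e' : b <= q.+1 -> e <= b -> b' <= q.+1 -> e' <= b' ->
  off b e = off b' e' -> (b, e) = (b', e').
Proof.
have mid x y : y <= x -> x != 0 -> x <= q -> [/\ x * d - y + y = x * d,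
  d <= x * d - y + 1 & x * d - y + 2 <= M].
  move=> leyx x0 lexq.
  have lexd : x * d <= q * d by rewrite leq_mul2r lexq orbT.
  have ledx : d + x <= x * d + 1 by case: x x0 {leyx lexq lexd} => // x _; nia.
  by split; lia.
move=> leb lee leb' lee'; rewrite /off.
case: eqP => [b0|/eqP b0]; case: eqP => [b0'|/eqP b0'].
- by move=> _; congr (_, _); lia.
- case: leqP => ? ?; last lia.
  by have [] := mid b' e'; lia.
- case: leqP => ? ?; last lia.
  by have [] := mid b e; lia.
case: leqP => leq; case: leqP => leq' E.
- have [E1 _ _] := mid _ _ lee b0 leq.
  have [E2 _ _] := mid _ _ lee' b0' leq'.
  have bb' : b = b'.
    have ltM x y : x < y -> x * d + d <= y * d.
      by move=> ltxy; rewrite -mulSnr leq_mul2r ltxy orbT.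
    by case: (ltngtP b b') => // /ltM; lia.
  by subst b'; congr (_, _); lia.
- by have [] := mid b e; lia.
- by have [] := mid b' e'; lia.
- by congr (_, _); lia.
Qed.

Let size_D : 2 * size D = (q + 2) * (q + 3).
Proof.
rewrite size_allpairs_dep (eq_map (g := S)); last first.
  by move=> b; rewrite size_iota.
have -> : q + 2 = q.+2 by lia. have -> : q + 3 = q.+2.+1 by lia.
elim: q.+2 => // n IHn.
by rewrite -[in iota 0 n.+1]addn1 iotaD map_cat sumn_cat mulnDr IHn /=; lia.
Qed.

(** The [+ 1] raises row 0 from [K] to [K.+1], so that each row b <= q contributes (b + 1)(K + 1 -
    b(i + 2)); row q + 1 contributes 0. The factor 6 clears denominators. *)
Let sumn_N :
  6 * (sumn [seq N p | p <- D] + 1) + 2 * (i + 2) * q * (q + 1) * (q + 2)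
    = 3 * K.+1 * (q + 1) * (q + 2).
Proof.
have -> : sumn [seq N p | p <- D] = \sum_(b < q.+2) b.+1 * N (val b, 0).
  rewrite sumnE big_map big_allpairs_dep.
  rewrite -(big_mkord xpredT (fun b => b.+1 * N (b, 0))).
  apply: eq_bigr => b _.
  rewrite (eq_bigr (fun=> N (b, 0))) //.
  by rewrite big_const_seq count_predT size_iota iter_addn_0 mulnC.
rewrite big_ord_recr /= N_top muln0 addn0.
suff sumE k : k <= q -> 6 * (\sum_(b < k.+1) b.+1 * N (val b, 0) + 1) +
    2 * (i + 2) * k * (k + 1) * (k + 2) = 3 * K.+1 * (k + 1) * (k + 2).
  exact: sumE.
elim: k => [_|k IHk lek].
  by rewrite big_ord1 /= /N /=; lia.
rewrite big_ord_recr /=; have := IHk (ltnW lek).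
have := @N_mid k.+1 0 isT lek.
move: (\sum_(_ < _) _) (N _) => s n.
by move=> <-; nia.
Qed.

(** [P] and [L] count the minimal generators and the left elements; equations free of division and
    subtraction transfer directly to the rationals. *)
Lemma wilf_number_family : exists P L : nat,
  [/\ 2 * P + (q + 2) * (q + 3) = 2 * (M + 3),
      6 * (L + 1) + 2 * (i + 2) * q * (q + 1) * (q + 2)
        = 3 * K.+1 * (q + 1) * (q + 2)
    & wilf_number (gen_numsg [:: M; G; G.+1] C) = ((P * L)%N%:Z - C%:Z)%R].
Proof.
exists (3 + M - size D), (sumn [seq N p | p <- D]); split=> //.
  rewrite -size_D addnC -mulnDr subnKC ?(addnC 3) //.
  have leqd : q * (q + 4) <= q * d by rewrite leq_mul2l; lia.
  by have := size_D; rewrite ME; lia.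
have ltMG : M < G by move: GE; rewrite mulnDl; lia.
have leiK : i <= i * (q + 1) by rewrite leq_pmulr; lia.
have leKM : (i + 2) * M <= K * M by rewrite leq_mul2r; lia.
have C_gt0 : G.+1 < C by lia.
apply: wilf_number_consec => //.
- by rewrite ME; lia.
(* Modulo [M], [G] is -d and [G.+1] is -(d - 1), both nonzero as 1 < d < M. *)
- apply/negP => dvdG; have : M %| G + d by rewrite GE dvdn_mull.
  by rewrite dvdn_addr // => /dvdn_leq; lia.
- apply/negP => dvdG; have : M %| G.+1 + d.-1.
    have -> : G.+1 + d.-1 = (i + 2) * M by lia.
    by rewrite dvdn_mull.
  by rewrite dvdn_addr // => /dvdn_leq; lia.
- apply: allpairs_uniq_dep; rewrite ?iota_uniq //.
    by move=> *; exact: iota_uniq.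
  by move=> [b e] [b' e'] _ _ /= [-> ->].
- by move=> [b e]; rewrite mem_D => /andP[].
- move=> [b e] [b' e']; rewrite !mem_D => /andP[leb lee] /andP[leb' lee'] E.
  have {}E : v (b, e) = v (b', e') := E.
  apply: off_inj => //; have := vE leb lee.
  by rewrite E -(vE leb' lee') => /addnI.
- move=> [b e]; rewrite mem_D => /andP[leb lee].
  have := vE leb lee; have := off_gt leb lee.
  rewrite -[X in _ -> _ -> _ <= X < _]/(v (b, e)).
  by move: (v _) (off b e) => x y; rewrite mulSn; lia.
- move=> b e lee; rewrite mem_D lee andbT -ltnNge => ltb.
  (* Already (q + 2)G = (K + i + 3)M - 2d + 2 exceeds (K + 1)M, because d < M. *)
  have leG : q.+2 * G <= b * G by rewrite leq_mul2r ltb orbT.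
  have E : q.+2 * G + q.+2 * d = (K + 3 + i) * M + M.
    by rewrite -mulnDr GE mulnA -mulSnr; congr (_ * _); rewrite KE; lia.
  have dE : q.+2 * d + 2 = M + 2 * d by rewrite ME; lia.
  by move: E; rewrite !mulnDl; lia.
(* [C.-1 + M] has offset t + 1, but rows b <= q have offsets at least d - q >= t + 4; only row q +
   1, where [N] is 0, can reach it. *)
- move=> [b e]; rewrite mem_D => /andP[leb lee] N0 E.
  have leq : b <= q.
    rewrite leqNgt; apply/negP => ?; have bE : b = q.+1 by lia.
    by rewrite bE N_top in N0.
  have := vE leb lee; rewrite {1}/v E mulSn -CE /off.
  case: eqP => [?|/eqP b0]; first lia.
  have : d <= b * d by rewrite leq_pmull // lt0n.
  by rewrite leq; lia.
Qed.

End Family.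

(** * Specialization to p, tau, i, j *)

(* All the natural number divisions and subtractions below are exact, since
   p is even and positive. *)
Theorem theorem5p15 (p tau i j : nat) (p_gt0 : (0 < p)%N) (p_even : ~~ odd p) :
  let mu := (p ^ 2 %/ 4 + 2 * p + 2)%N in
  let gamma := (2 * mu - (p %/ 2 + 4))%N in
  let m := (mu + tau * (p %/ 2))%N in
  let g := (gamma + tau * (p - 1))%N in
  let c := (p * mu + tau * (p ^ 2 %/ 2 - 1))%N in
  let mij := (m + j * (p %/ 2))%N in
  let gij := (g + j * (p - 1) + i * mij)%N in
  let cij := (c + j * (p ^ 2 %/ 2) + i * (p %/ 2 + 1) * mij)%N in
  let Sij := gen_numsg [:: mij; gij; gij.+1] cij in
  let P : rat := p%:R in
  let T : rat := tau%:R in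
  let I : rat := i%:R in
  let J : rat := j%:R in
  (wilf_number Sij)%:~R =
    P ^+ 5 / 192 + 5 * P ^+ 4 / 64 + P ^+ 3 / 4 - 7 * P ^+ 2 / 16 + P / 6
    + T * (P ^+ 4 / 48 + 3 / 16 * P ^+ 3 + 1 / 24 * P ^+ 2 + 1)
    + I * (P ^+ 5 / 384 + 3 * P ^+ 4 / 64 + 7 * P ^+ 3 / 32 + P ^+ 2 / 16
           - 5 * P / 12)
    + J * (P ^+ 4 / 48 + 3 * P ^+ 3 / 16 + P ^+ 2 / 24)
    + I * J * (P ^+ 4 / 96 + P ^+ 3 / 8 + 5 * P ^+ 2 / 24)
    + I * T * (P ^+ 4 / 96 + P ^+ 3 / 8 + 5 * P ^+ 2 / 24).
Proof.
have [q pE] : exists q, p = (2 * q)%N by exists p./2; lia.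
have q_gt0 : (0 < q)%N by lia.
have p_half : (p %/ 2 = q)%N by rewrite pE mulKn.
have p2_quarter : (p ^ 2 %/ 4 = q * q)%N by rewrite pE expnMn mulKn.
have p2_half : (p ^ 2 %/ 2 = 2 * (q * q))%N.
  by rewrite pE expnMn -[(2 ^ 2)%N]/(2 * 2)%N -mulnA mulKn.
rewrite p_half p2_quarter p2_half => mu gamma m g c mij gij cij Sij P T I J.
pose d := (q + 4 + tau + j)%N; pose K := (2 * q + i * (q + 1))%N.
have mE : mij = (q * d + 2)%N by rewrite /mij /m /mu pE /d; lia.
have gammaE : (gamma + (q + 4) = 2 * mu)%N.
  by rewrite /gamma subnK // /mu; lia.
have mulB1 k r : (0 < r)%N -> (k * (r - 1) + k = k * r)%N.
  by move=> r_gt0; rewrite mulnBr muln1 subnK // leq_pmulr.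
have gE : (gij + d = (i + 2) * mij)%N.
  have := mulB1 tau p p_gt0; have := mulB1 j p p_gt0.
  rewrite /gij /g mulnDl; move: gammaE.
  move: (gamma) (_ * (_ - 1))%N (_ * (_ - 1))%N (i * mij)%N.
  by rewrite mE /mu pE /d; clear => *; lia.
have cE : (cij + tau = K * mij)%N.
  have := mulB1 tau (2 * (q * q))%N; rewrite !muln_gt0 q_gt0 => /(_ isT).
  rewrite /cij /c -mulnA /K mulnDl.
  move: (tau * (_ - 1))%N (i * ((q + 1) * mij))%N.
  by rewrite mE /mu pE /d; clear => *; lia.
have [|Pn [Ln [PE LE WE]]] :=
    @wilf_number_family q d tau i mij gij K cij q_gt0 _ mE gE erefl cE.
  by rewrite /d; lia.
have {}WE : wilf_number Sij = ((Pn * Ln)%N%:Z - cij%:Z) := WE.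
rewrite {}WE rmorphB /= -!pmulrn natrM /P /T /I /J pE natrM.
move: (mij) (cij) mE PE LE cE; rewrite /d /K; clear => M C mE PE LE cE.
(* Solving for [M], [C], [Pn] and [Ln] over the rationals turns the claim into a polynomial identity
   in q, tau, i, j. *)
have MQ : M%:R = q%:R * (q%:R + 4 + tau%:R + j%:R) + 2 :> rat.
  by rewrite mE !(natrD, natrM).
have CQ : C%:R = (2 * q%:R + i%:R * (q%:R + 1)) * M%:R - tau%:R :> rat.
  by apply/eqP; rewrite eq_sym subr_eq -natrD cE !(natrD, natrM).
have PQ : Pn%:R = M%:R + 3 - (q%:R + 2) * (q%:R + 3) / 2 :> rat.
  have := congr1 (fun n => n%:R : rat) PE.
  by rewrite !(natrD, natrM) => ?; lra.
have LQ : Ln%:R =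
    (2 * q%:R + i%:R * (q%:R + 1) + 1) * (q%:R + 1) * (q%:R + 2) / 2
    - (i%:R + 2) * q%:R * (q%:R + 1) * (q%:R + 2) / 3 - 1 :> rat.
  have := congr1 (fun n => n%:R : rat) LE.
  by rewrite -addn1 !(natrD, natrM) => ?; lra.
by rewrite PQ LQ CQ MQ; field.
Qed.
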